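(* Let $a,b,c,d$ be real numbers with $(|a|+|b|)(|c|+|d|)\neq 0$, let $x_0,y_0\in\mathbb{R}$, and consider the system of difference equations $$x_{n+1}=ax_n^2y_n+bx_ny_n^2,\qquad y_{n+1}=cx_n^2y_n+dx_ny_n^2,\qquad n\in\mathbb{N}_0,$$ with initial values $x_0,y_0$. Let $Z_0,Z_1,Z_2,Z_3$ be the sets defined in the context. Then the following statements hold. 1. If $ad-bc=0$ and $(x_0,y_0)\notin Z_0$, then the general solution to the system is given, for all $n\ge 1$, by $$x_n=\left(ax_0^2y_0+bx_0y_0^2\right)^{3^{n-1}}\left(c+b\left(\tfrac{c}{a}\right)^2\right)^{\frac{3^{n-1}-1}{2}},\qquad y_n=\frac{c}{a}\left(ax_0^2y_0+bx_0y_0^2\right)^{3^{n-1}}\left(c+b\left(\tfrac{c}{a}\right)^2\right)^{\frac{3^{n-1}-1}{2}}.$$ 2. If $ad-bc\neq 0$, $(a-d)^2+4bc=0$, $a+d\neq 0$ and $(x_0,y_0)\notin Z_2$, then the general solution to the system is given, for all $n\in\mathbb{N}_0$, by $$x_n=x_0^{3^n}\prod_{k=0}^{n-1}\left(a\frac{c_3+c_4k}{c_1+c_2k}+b\left(\frac{c_3+c_4k}{c_1+c_2k}\right)^2\right)^{3^{n-k-1}},$$ $$y_n=\frac{c_3+c_4n}{c_1+c_2n}\,x_0^{3^n}\prod_{k=0}^{n-1}\left(a\frac{c_3+c_4k}{c_1+c_2k}+b\left(\frac{c_3+c_4k}{c_1+c_2k}\right)^2\right)^{3^{n-k-1}},$$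 where $c_1=\frac{a+d}{2}x_0$, $c_2=\frac{a-d}{2}x_0+by_0$, $c_3=\frac{a+d}{2}y_0$, $c_4=cx_0+\frac{d-a}{2}y_0$. 3. If $ad-bc\neq 0$, $(a-d)^2+4bc\neq 0$, $a+d\neq 0$ and $(x_0,y_0)\notin Z_1$, then the general solution to the system is given, for all $n\in\mathbb{N}_0$, by $$x_n=x_0^{3^n}\prod_{k=0}^{n-1}\left(a\frac{C_3\lambda_1^k-C_4\lambda_2^k}{C_1\lambda_1^k-C_2\lambda_2^k}+b\left(\frac{C_3\lambda_1^k-C_4\lambda_2^k}{C_1\lambda_1^k-C_2\lambda_2^k}\right)^2\right)^{3^{n-k-1}},$$ $$y_n=\frac{C_3\lambda_1^n-C_4\lambda_2^n}{C_1\lambda_1^n-C_2\lambda_2^n}\,x_0^{3^n}\prod_{k=0}^{n-1}\left(a\frac{C_3\lambda_1^k-C_4\lambda_2^k}{C_1\lambda_1^k-C_2\lambda_2^k}+b\left(\frac{C_3\lambda_1^k-C_4\lambda_2^k}{C_1\lambda_1^k-C_2\lambda_2^k}\right)^2\right)^{3^{n-k-1}},$$ where $$C_1=\frac{b}{\lambda_1-\lambda_2}\left(\frac{c}{\lambda_1-a}x_0+y_0\right),\quad C_2=\frac{b}{\lambda_1-\lambda_2}\left(\frac{c}{\lambda_2-a}x_0+y_0\right),$$ $$C_3=\frac{1}{\lambda_1-\lambda_2}\left(cx_0+(\lambda_1-a)y_0\right),\quad C_4=\frac{1}{\lambda_1-\lambda_2}\left(cx_0+(\lambda_2-a)y_0\right).$$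 4. If $ad-bc\neq 0$, $(a-d)^2+4bc\neq 0$, $a+d=0$ and $(x_0,y_0)\notin Z_3$, then, writing $$K=a\frac{y_0}{x_0}+b\left(\frac{y_0}{x_0}\right)^2,\qquad L=a\frac{cx_0+dy_0}{ax_0+by_0}+b\left(\frac{cx_0+dy_0}{ax_0+by_0}\right)^2,$$ the general solution to the system is given, for all $n\in\mathbb{N}_0$, by $$x_{2n}=x_0^{3^{2n}}\left(LK^3\right)^{\frac{3^{2n}-1}{8}},\qquad x_{2n+1}=x_0^{3^{2n+1}}K\left(LK^3\right)^{\frac{3^{2n+1}-3}{8}},$$ $$y_{2n}=\frac{y_0}{x_0}x_0^{3^{2n}}\left(LK^3\right)^{\frac{3^{2n}-1}{8}},\qquad y_{2n+1}=\frac{cx_0+dy_0}{ax_0+by_0}x_0^{3^{2n+1}}K\left(LK^3\right)^{\frac{3^{2n+1}-3}{8}}.$$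
   Context: $\mathbb{N}_0=\{0,1,2,\dots\}$. Empty products equal $1$. $\lambda_1,\lambda_2$ denote the eigenvalues of the matrix $A=\begin{bmatrix}a&b\\c&d\end{bmatrix}$; they are distinct when $(a-d)^2+4bc\neq0$. The sets of initial values $(x_0,y_0)$ are defined as follows. $Z_0=\{(x_0,y_0): x_0y_0=0 \text{ or } ax_0+by_0=0\}$. $Z_1$ (defined when $ad-bc\neq0$ and $(a-d)^2+4bc\ne0$) is the set of $(x_0,y_0)$ such that for some $n\in\mathbb{N}_0$ either $((a-\lambda_2)\lambda_1^n-(a-\lambda_1)\lambda_2^n)x_0+b(\lambda_1^n-\lambda_2^n)y_0=0$ or $c(\lambda_1^n-\lambda_2^n)x_0+((d-\lambda_2)\lambda_1^n-(d-\lambda_1)\lambda_2^n)y_0=0$. $Z_2$ (defined when $ad-bc\neq0$ and $(a-d)^2+4bc=0$) is the set of $(x_0,y_0)$ such that for some $n\in\mathbb{N}_0$ either $\left(\frac{a+d}{2}+n\frac{a-d}{2}\right)x_0+bny_0=0$ or $cnx_0+\left(\frac{a+d}{2}+n\frac{d-a}{2}\right)y_0=0$. $Z_3=\{(x_0,y_0): x_0y_0=0 \text{ or } ax_0+by_0=0 \text{ or } cx_0+dy_0=0\}$.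
   Formalization: Item 1 is stated with the extra condition a≠0, and item 3 with λ1≠a and λ2≠a (that is, bc≠0), because otherwise the quotients c/a, c/(λ1−a), c/(λ2−a) in the formulas are undefined. *)

(* Defs.v *)
From mathcomp Require Import all_boot all_order all_algebra.
From mathcomp Require Import classical_sets reals.
From mathcomp Require Export complex.
Set Implicit Arguments.
Unset Strict Implicit.
Unset Printing Implicit Defensive.
Import Order.TTheory GRing.Theory Num.Theory.
Local Open Scope ring_scope.
Local Open Scope complex_scope.
Local Open Scope classical_set_scope.

Definition is_solution (R : realType) (a b c d x0 y0 : R) (x y : nat -> R) :=
  [/\ x 0%N = x0, y 0%N = y0
    & forall n : nat,
        x n.+1 = a * x n ^+ 2 * y n + b * x n * y n ^+ 2 /\
        y n.+1 = c * x n ^+ 2 * y n + d * x n * y n ^+ 2].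

Definition coefmx (R : realType) (a b c d : R) : 'M[R]_2 :=
  \matrix_(i < 2, j < 2)
    if i == 0 then (if j == 0 then a else b) else (if j == 0 then c else d).

(* l1 and l2 are the eigenvalues in R[i] of the real matrix [[a, b], [c, d]],
   which need not be real; l1 = l2 exactly when there is a double eigenvalue. *)
Definition are_eigenvalues (R : realType) (a b c d : R) (l1 l2 : R[i]) :=
  forall l : R[i],
    eigenvalue (map_mx (real_complex R) (coefmx a b c d)) l <-> l = l1 \/ l = l2.

Definition Z0 (R : realType) (a b : R) : set (R * R) :=
  [set p | p.1 * p.2 = 0 \/ a * p.1 + b * p.2 = 0].

Definition Z1 (R : realType) (a b c d : R) (l1 l2 : R[i]) : set (R * R) :=
  [set p | exists n : nat,
    ((a%:C - l2) * l1 ^+ n - (a%:C - l1) * l2 ^+ n) * (p.1)%:C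
      + b%:C * (l1 ^+ n - l2 ^+ n) * (p.2)%:C = 0
    \/
    c%:C * (l1 ^+ n - l2 ^+ n) * (p.1)%:C
      + ((d%:C - l2) * l1 ^+ n - (d%:C - l1) * l2 ^+ n) * (p.2)%:C = 0].

Definition Z2 (R : realType) (a b c d : R) : set (R * R) :=
  [set p | exists n : nat,
    ((a + d) / 2 + n%:R * ((a - d) / 2)) * p.1 + b * n%:R * p.2 = 0
    \/
    c * n%:R * p.1 + ((a + d) / 2 + n%:R * ((d - a) / 2)) * p.2 = 0].

Definition Z3 (R : realType) (a b c d : R) : set (R * R) :=
  [set p | [\/ p.1 * p.2 = 0, a * p.1 + b * p.2 = 0 | c * p.1 + d * p.2 = 0]].

(* Main.v *)
Require Import Defs.
From mathcomp Require Import all_boot all_order all_algebra.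
From mathcomp Require Import classical_sets reals.
From mathcomp Require Import ring zify.
Import Order.TTheory GRing.Theory Num.Theory.
Local Open Scope ring_scope.
Local Open Scope complex_scope.
Set Implicit Arguments.
Unset Strict Implicit.

(** Both components of the system carry the same factor x_n y_n, so the ratio
    r_n = y_n / x_n evolves by itself, by the homography
    r |-> (c + d r) / (a + b r), that is, by the projective action of the
    matrix A = [a b; c d].  Substituting y_n = r_n x_n in the first equation
    leaves a cubing recurrence x_{n+1} = x_n^3 (a r_n + b r_n^2), which unrolls
    to x_0^(3^n) times a product of powers of the factors a r_k + b r_k^2
    ([cubing_recurrence]).

    A closed form of r_n comes from any sequence of vectors (u_n, v_n) with
    u_n != 0, starting on the line of (x_0, y_0), such that A maps the line of
    each vector to that of the next: then r_n = v_n / u_n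
    ([solution_of_linear_orbit]).  When A is invertible, the excluded
    initial values are those for which some u_n or v_n vanishes.
    The four cases differ by the shape of the orbit of (x_0, y_0) under A:
    - if A is singular, its image is the line of slope c / a and r_n is
      constant from n = 1 on;
    - if A has a double eigenvalue m, then N = A - m satisfies N^2 = 0 and A^n
      is proportional to m + n N, so u_n and v_n are affine in n
      ([double_eigenvalue_orbit]);
    - if the eigenvalues are distinct, u_n and v_n are combinations of their
      powers ([distinct_eigenvalues_orbit]); the eigenvalues may be complex,
      so this orbit lives in R[i];
    - if the trace is 0, then A^2 is scalar and r_n has period 2. *)

(** * Cubing recurrences and the ratio of the two components *)

Lemma cubing_recurrence (F : comPzRingType) (x q : nat -> F)
    (Hx : forall n, x n.+1 = x n ^+ 3 * q n) (n : nat) :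
  x n = x 0%N ^+ (3 ^ n) * \prod_(0 <= k < n) q k ^+ (3 ^ (n - k - 1)).
Proof.
elim: n => [|n IHn]; first by rewrite big_nil mulr1 expn0 expr1.
rewrite Hx IHn exprMn -exprM -expnSr big_nat_recr //= -mulrA.
rewrite subSnn subnn expn0 expr1 -prodrXl.
congr (_ * (_ * _)); apply: eq_big_nat => k /andP[_ ltkn].
by rewrite -exprM -expnSr; congr (_ ^+ (3 ^ _)); lia.
Qed.

Lemma cubing_recurrence_const (F : comPzRingType) (x : nat -> F) (q : F)
    (Hx : forall n, x n.+1 = x n ^+ 3 * q) (n : nat) :
  x n = x 0%N ^+ (3 ^ n) * q ^+ ((3 ^ n - 1) %/ 2).
Proof.
elim: n => [|n IHn]; first by rewrite expr1 mulr1.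
rewrite Hx IHn exprMn -!exprM -mulrA -exprSr -expnSr.
congr (_ * _ ^+ _).
have : odd (3 ^ n) by rewrite oddX orbT.
rewrite expnS; lia.
Qed.

(** A step x -> x^3 K followed by a step x -> x^3 L is x -> x^9 (L K^3), so that
    the exponent of L K^3 satisfies e -> 9 e + 1, whence (9^n - 1) / 8. *)
Lemma cubing_recurrence_alt (F : comPzRingType) (x : nat -> F) (K L : F)
    (HK : forall n, x (2 * n).+1 = x (2 * n)%N ^+ 3 * K)
    (HL : forall n, x (2 * n).+2 = x (2 * n).+1 ^+ 3 * L) (n : nat) :
  x (2 * n)%N = x 0%N ^+ (3 ^ (2 * n)) * (L * K ^+ 3) ^+ ((3 ^ (2 * n) - 1) %/ 8)
  /\ x (2 * n + 1)%N = x 0%N ^+ (3 ^ (2 * n + 1)) * K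
       * (L * K ^+ 3) ^+ ((3 ^ (2 * n + 1) - 3) %/ 8).
Proof.
have mod8 m : (3 ^ (2 * m) %% 8 = 1)%N.
  by rewrite expnM -modnXm exp1n.
have even m : x (2 * m)%N =
    x 0%N ^+ (3 ^ (2 * m)) * (L * K ^+ 3) ^+ ((3 ^ (2 * m) - 1) %/ 8).
  elim: m => [|m IHm]; first by rewrite muln0 expr1 mulr1.
  have -> : (2 * m.+1 = (2 * m).+2)%N by lia.
  rewrite HL HK IHm !expnSr !exprM.
  (* the truncated quotient follows e -> 9 e + 1 because 8 divides 9^m - 1 *)
  have -> : ((3 ^ (2 * m) * 3 * 3 - 1) %/ 8 = (3 ^ (2 * m) - 1) %/ 8 * 9 + 1)%N.
    by have := mod8 m; lia.
  rewrite exprD exprM; ring.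
split=> //; rewrite addn1 HK even expnSr.
have -> : ((3 ^ (2 * n) * 3 - 3) %/ 8 = (3 ^ (2 * n) - 1) %/ 8 * 3)%N.
  by have := mod8 n; lia.
rewrite !exprM; ring.
Qed.

Section Ratio.
Variables (F : fieldType) (a b c d : F) (x y : nat -> F).
Hypothesis Hx : forall n, x n.+1 = a * x n ^+ 2 * y n + b * x n * y n ^+ 2.
Hypothesis Hy : forall n, y n.+1 = c * x n ^+ 2 * y n + d * x n * y n ^+ 2.

(** Writing y n = r n x n instead of r n = y n / x n covers the solutions that
    reach 0 and stay there: r follows the homography in any case. *)
Lemma ratio_step (r : nat -> F) (r0 : y 0%N = r 0%N * x 0%N)
    (rS : forall n, c + d * r n = r n.+1 * (a + b * r n)) (n : nat) :
  y n = r n * x n /\ x n.+1 = x n ^+ 3 * (a * r n + b * r n ^+ 2).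
Proof.
have yr : y n = r n * x n.
  elim: n => // n IHn; rewrite Hx Hy IHn.
  transitivity (x n ^+ 3 * r n * (c + d * r n)); first by ring.
  by rewrite rS; ring.
by split=> //; rewrite Hx yr; ring.
Qed.

(** The hypothesis says that (u n.+1, v n.+1) is parallel to the image of
    (u n, v n) by [a b; c d]: asking for proportionality only lets each case
    pick the most convenient multiples of the iterates. *)
Lemma projective_orbit_ratio (u v : nat -> F) (u_neq0 : forall n, u n != 0)
    (uv : forall n,
       u n.+1 * (c * u n + d * v n) = v n.+1 * (a * u n + b * v n)) (n : nat) :
  c + d * (v n / u n) = v n.+1 / u n.+1 * (a + b * (v n / u n)).
Proof.
have un := u_neq0 n; have uSn := u_neq0 n.+1.
apply: (mulfI un); apply: (mulfI uSn).
transitivity (u n.+1 * (c * u n + d * v n)); first by field.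
by rewrite uv; field; rewrite un.
Qed.

Lemma solution_of_linear_orbit (u v : nat -> F) (u_neq0 : forall n, u n != 0)
    (uv0 : y 0%N * u 0%N = v 0%N * x 0%N)
    (uv : forall n,
       u n.+1 * (c * u n + d * v n) = v n.+1 * (a * u n + b * v n)) (n : nat) :
  let r k := v k / u k in
  x n = x 0%N ^+ (3 ^ n)
        * \prod_(0 <= k < n) (a * r k + b * r k ^+ 2) ^+ (3 ^ (n - k - 1)) /\
  y n = r n * x 0%N ^+ (3 ^ n)
        * \prod_(0 <= k < n) (a * r k + b * r k ^+ 2) ^+ (3 ^ (n - k - 1)).
Proof.
move=> r.
have r0 : y 0%N = r 0%N * x 0%N.
  by rewrite mulrAC -uv0 mulfK.
have step := ratio_step r0 (projective_orbit_ratio u_neq0 uv).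
have xE := cubing_recurrence (fun k => (step k).2) n.
by split=> //; rewrite (step n).1 {1}xE mulrA.
Qed.

End Ratio.

(** * Eigenvalues of a real two by two matrix *)

Lemma eigenvalue_mx2 (F : fieldType) (A : 'M[F]_2) (l : F) :
  eigenvalue A l = (l ^+ 2 - \tr A * l + \det A == 0).
Proof.
rewrite eigenvalue_root_char rootE horner_coef size_char_poly.
rewrite !big_ord_recl big_ord0 /= char_poly_det char_poly_trace //.
have /monicP := char_poly_monic A; rewrite /lead_coef size_char_poly => -> .
by congr (_ == 0); ring.
Qed.

(** If l1 is a root of the characteristic polynomial X^2 - t X + p, then so is
    t - l1; it is therefore l1 or l2, and it cannot be l1 when the discriminant
    t^2 - 4 p = (a - d)^2 + 4 b c is nonzero. *)
Lemma eigenvalues_sum_prod (R : realType) (a b c d : R) (l1 l2 : R[i])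
    (Heig : are_eigenvalues a b c d l1 l2)
    (disc : (a - d) ^+ 2 + 4 * b * c != 0) :
  [/\ l1 != l2, l1 + l2 = a%:C + d%:C
    & l1 * l2 = a%:C * d%:C - b%:C * c%:C].
Proof.
set t := a%:C + d%:C; set p := a%:C * d%:C - b%:C * c%:C.
have eigE l : (l = l1 \/ l = l2) <-> l ^+ 2 - t * l + p = 0.
  rewrite -Heig eigenvalue_mx2 det_map_mx trace_map_mx.
  have -> : \tr (coefmx a b c d) = a + d.
    by rewrite /mxtrace !big_ord_recl big_ord0 !mxE /= addr0.
  have -> : \det (coefmx a b c d) = a * d - b * c.
    rewrite (expand_det_row _ ord0) !big_ord_recl big_ord0 /cofactor !det_mx11.
    by rewrite !mxE /=; ring.
  by rewrite rmorphB !rmorphM rmorphD; split=> /eqP.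
have tp : t ^+ 2 - 4 * p != 0.
  have -> : t ^+ 2 - 4 * p = ((a - d) ^+ 2 + 4 * b * c)%:C.
    by rewrite rmorphD rmorphXn rmorphB !rmorphM rmorph_nat /t /p; ring.
  by rewrite fmorph_eq0.
have p1 : l1 ^+ 2 - t * l1 + p = 0 by apply/eigE; left.
have /eigE[l1E|l2E] : (t - l1) ^+ 2 - t * (t - l1) + p = 0.
- by rewrite -p1; ring.
- case/eqP: tp; have -> : t = l1 + l1 by rewrite -{1}l1E subrK.
  transitivity (- 4 * (l1 ^+ 2 - t * l1 + p)); last by rewrite p1 mulr0.
  have -> : t = l1 + l1 by rewrite -{1}l1E subrK.
  by ring.
have tE : t = l1 + l2 by rewrite -l2E addrC subrK.
split=> //.
  apply: contraNneq tp => l12.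
  have -> : t ^+ 2 - 4 * p = (t - 2 * l1) ^+ 2 - 4 * (l1 ^+ 2 - t * l1 + p).
    by ring.
  by rewrite p1 tE -l12; apply/eqP; ring.
by apply/eqP; rewrite eq_sym -subr_eq0 -p1 tE; apply/eqP; ring.
Qed.

(** * The four closed forms *)

(** With m = (a + d) / 2 and N = [a b; c d] - m, the vector (u k, v k) is
    (m + k N) (x0, y0).  Since (m + N) (m + k N) = m (m + (k + 1) N) + k N^2,
    the two sides differ by k N^2 (x0, y0), and N^2 is the scalar
    ((a - d)^2 + 4 b c) / 4. *)
Lemma double_eigenvalue_orbit (F : numFieldType) (a b c d x0 y0 : F)
    (disc : (a - d) ^+ 2 + 4 * b * c = 0) (n : nat) :
  let u k := (a + d) / 2 * x0 + ((a - d) / 2 * x0 + b * y0) * k%:R in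
  let v k := (a + d) / 2 * y0 + (c * x0 + (d - a) / 2 * y0) * k%:R in
  (a + d) / 2 * u n.+1 = a * u n + b * v n /\
  (a + d) / 2 * v n.+1 = c * u n + d * v n.
Proof.
move=> u v; rewrite /u /v -natr1; split; apply/eqP; rewrite -subr_eq0.
- apply/eqP; transitivity (- (n%:R * x0 / 4) * ((a - d) ^+ 2 + 4 * b * c)).
    by field.
  by rewrite disc mulr0.
- apply/eqP; transitivity (- (n%:R * y0 / 4) * ((a - d) ^+ 2 + 4 * b * c)).
    by field.
  by rewrite disc mulr0.
Qed.

(** Here (u k, v k) is (l1 - l2) [a b; c d]^k (x0, y0), read off from
    (l1 - l2) A^k = (A - l2) l1^k - (A - l1) l2^k.  Each power term follows the
    linear recursion because (A - l1) (A - l2) = 0, the Cayley-Hamilton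
    relation. *)
Lemma distinct_eigenvalues_orbit (F : fieldType) (a b c d l1 l2 x0 y0 : F)
    (sum12 : l1 + l2 = a + d) (prod12 : l1 * l2 = a * d - b * c) (n : nat) :
  let u k := ((a - l2) * l1 ^+ k - (a - l1) * l2 ^+ k) * x0
             + b * (l1 ^+ k - l2 ^+ k) * y0 in
  let v k := c * (l1 ^+ k - l2 ^+ k) * x0
             + ((d - l2) * l1 ^+ k - (d - l1) * l2 ^+ k) * y0 in
  u n.+1 = a * u n + b * v n /\ v n.+1 = c * u n + d * v n.
Proof.
move=> u v; rewrite /u /v !exprS.
have bc : b * c = a * d - l1 * l2 by rewrite prod12; ring.
have dE : d = l1 + l2 - a by rewrite sum12; ring.
split; apply/eqP; rewrite -subr_eq0; apply/eqP.
- transitivity ((l1 ^+ n - l2 ^+ n) * x0 * (a * d - l1 * l2 - b * c)).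
    by rewrite dE; ring.
  by rewrite bc subrr mulr0.
- transitivity ((l1 ^+ n - l2 ^+ n) * y0 * (a * d - l1 * l2 - b * c)).
    by rewrite dE; ring.
  by rewrite bc subrr mulr0.
Qed.

(** The numbers C1, - C2, C3, - C4 are, up to the factor l1 - l2, the coordinates
    of the orbit of [distinct_eigenvalues_orbit] on the powers of l1 and l2.
    The quotients in C1 and C2 simplify since (l1 - a) (a - l2) = b c, that is,
    b c / (l1 - a) = a - l2 and b c / (l2 - a) = a - l1. *)
Lemma eigen_coordinates (F : fieldType) (a b c d l1 l2 x0 y0 : F)
    (l12 : l1 != l2) (l1a : l1 != a) (l2a : l2 != a)
    (sum12 : l1 + l2 = a + d) (prod12 : l1 * l2 = a * d - b * c) (k : nat) :
  let C1 := b / (l1 - l2) * (c / (l1 - a) * x0 + y0) in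
  let C2 := b / (l1 - l2) * (c / (l2 - a) * x0 + y0) in
  let C3 := 1 / (l1 - l2) * (c * x0 + (l1 - a) * y0) in
  let C4 := 1 / (l1 - l2) * (c * x0 + (l2 - a) * y0) in
  C1 * l1 ^+ k - C2 * l2 ^+ k
    = (((a - l2) * l1 ^+ k - (a - l1) * l2 ^+ k) * x0
       + b * (l1 ^+ k - l2 ^+ k) * y0) / (l1 - l2) /\
  C3 * l1 ^+ k - C4 * l2 ^+ k
    = (c * (l1 ^+ k - l2 ^+ k) * x0
       + ((d - l2) * l1 ^+ k - (d - l1) * l2 ^+ k) * y0) / (l1 - l2).
Proof.
rewrite -subr_eq0 in l12; rewrite -subr_eq0 in l1a; rewrite -subr_eq0 in l2a.
have dE : d = l1 + l2 - a by rewrite sum12; ring.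
have bc : b * c = (l1 - a) * (a - l2).
  transitivity (a * d - l1 * l2); first by rewrite prod12; ring.
  by rewrite dE; ring.
move=> C1 C2 C3 C4; split; last by rewrite /C3 /C4 dE; field.
have bc1 : b * c / (l1 - a) = a - l2 by rewrite bc mulrAC mulfV ?mul1r.
have bc2 : b * c / (l2 - a) = a - l1.
  apply: (mulIf l2a); rewrite divfK // bc; ring.
rewrite -bc1 -bc2 /C1 /C2; field.
by rewrite l12 l1a l2a.
Qed.

(* Exponents are natural numbers and the divisions %/ in them are exact.
   The premises a != 0 (1) and l1 != a, l2 != a (3) say that the quotients
   c / a, c / (l1 - a), c / (l2 - a) in the formulas are defined. *)
Theorem theorem5 (R : realType) (a b c d x0 y0 : R)
    (Hrows : (`|a| + `|b|) * (`|c| + `|d|) != 0)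
    (x y : nat -> R) (Hsol : is_solution a b c d x0 y0 x y) :
  (* 1 *)
  (a * d - b * c = 0 -> ~ Z0 a b (x0, y0) -> a != 0 ->
   forall n : nat, (1 <= n)%N ->
     x n = (a * x0 ^+ 2 * y0 + b * x0 * y0 ^+ 2) ^+ (3 ^ (n - 1))
           * (c + b * (c / a) ^+ 2) ^+ ((3 ^ (n - 1) - 1) %/ 2) /\
     y n = c / a * (a * x0 ^+ 2 * y0 + b * x0 * y0 ^+ 2) ^+ (3 ^ (n - 1))
           * (c + b * (c / a) ^+ 2) ^+ ((3 ^ (n - 1) - 1) %/ 2))
  /\
  (* 2 *)
  (a * d - b * c != 0 -> (a - d) ^+ 2 + 4 * b * c = 0 -> a + d != 0 ->
   ~ Z2 a b c d (x0, y0) ->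
   let c1 := (a + d) / 2 * x0 in
   let c2 := (a - d) / 2 * x0 + b * y0 in
   let c3 := (a + d) / 2 * y0 in
   let c4 := c * x0 + (d - a) / 2 * y0 in
   let r (k : nat) := (c3 + c4 * k%:R) / (c1 + c2 * k%:R) in
   forall n : nat,
     x n = x0 ^+ (3 ^ n)
           * \prod_(0 <= k < n) (a * r k + b * r k ^+ 2) ^+ (3 ^ (n - k - 1)) /\
     y n = r n * x0 ^+ (3 ^ n)
           * \prod_(0 <= k < n) (a * r k + b * r k ^+ 2) ^+ (3 ^ (n - k - 1)))
  /\
  (* 3 *)
  (forall l1 l2 : R[i], are_eigenvalues a b c d l1 l2 ->
   a * d - b * c != 0 -> (a - d) ^+ 2 + 4 * b * c != 0 -> a + d != 0 ->
   ~ Z1 a b c d l1 l2 (x0, y0) ->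
   l1 != a%:C -> l2 != a%:C ->
   let C1 := b%:C / (l1 - l2) * (c%:C / (l1 - a%:C) * x0%:C + y0%:C) in
   let C2 := b%:C / (l1 - l2) * (c%:C / (l2 - a%:C) * x0%:C + y0%:C) in
   let C3 := 1 / (l1 - l2) * (c%:C * x0%:C + (l1 - a%:C) * y0%:C) in
   let C4 := 1 / (l1 - l2) * (c%:C * x0%:C + (l2 - a%:C) * y0%:C) in
   let r (k : nat) :=
     (C3 * l1 ^+ k - C4 * l2 ^+ k) / (C1 * l1 ^+ k - C2 * l2 ^+ k) in
   forall n : nat,
     (x n)%:C = x0%:C ^+ (3 ^ n)
           * \prod_(0 <= k < n)
               (a%:C * r k + b%:C * r k ^+ 2) ^+ (3 ^ (n - k - 1)) /\
     (y n)%:C = r n * x0%:C ^+ (3 ^ n)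
           * \prod_(0 <= k < n)
               (a%:C * r k + b%:C * r k ^+ 2) ^+ (3 ^ (n - k - 1)))
  /\
  (* 4 *)
  (a * d - b * c != 0 -> (a - d) ^+ 2 + 4 * b * c != 0 -> a + d = 0 ->
   ~ Z3 a b c d (x0, y0) ->
   let s := (c * x0 + d * y0) / (a * x0 + b * y0) in
   let K := a * (y0 / x0) + b * (y0 / x0) ^+ 2 in
   let L := a * s + b * s ^+ 2 in
   forall n : nat,
     [/\ x (2 * n)%N =
           x0 ^+ (3 ^ (2 * n)) * (L * K ^+ 3) ^+ ((3 ^ (2 * n) - 1) %/ 8),
         x (2 * n + 1)%N =
           x0 ^+ (3 ^ (2 * n + 1)) * K
             * (L * K ^+ 3) ^+ ((3 ^ (2 * n + 1) - 3) %/ 8),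
         y (2 * n)%N =
           y0 / x0 * x0 ^+ (3 ^ (2 * n))
             * (L * K ^+ 3) ^+ ((3 ^ (2 * n) - 1) %/ 8)
       & y (2 * n + 1)%N =
           s * x0 ^+ (3 ^ (2 * n + 1)) * K
             * (L * K ^+ 3) ^+ ((3 ^ (2 * n + 1) - 3) %/ 8)]).
Proof.
case: Hsol => x0E y0E step.
have Hx k := (step k).1; have Hy k := (step k).2.
split; [|split; [|split]].
- move=> det0 _ a_neq0 [//|n] _; rewrite subn1 /=.
  have dE : d = b * c / a.
    by apply: (mulIf a_neq0); rewrite divfK // mulrC; apply: subr0_eq.
  have r1 : y 1%N = c / a * x 1%N.
    by rewrite Hx Hy dE; field.
  have rS (k : nat) : c + d * (c / a) = c / a * (a + b * (c / a)).
    by rewrite dE; field.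
  (* the slope is c / a only after the first step, so the index is shifted *)
  have shift := @ratio_step R a b c d (fun k => x k.+1) (fun k => y k.+1)
                  (fun k => Hx k.+1) (fun k => Hy k.+1) (fun=> c / a) r1 rS.
  have cube k : x k.+2 = x k.+1 ^+ 3 * (c + b * (c / a) ^+ 2).
    by rewrite (shift k).2; congr (_ * (_ + _)); rewrite mulrC divfK.
  have := cubing_recurrence_const (x := fun k => x k.+1) cube n.
  rewrite /= (Hx 0%N) x0E y0E => xE.
  by split=> //; rewrite (shift n).1 xE mulrA.
- move=> _ disc tr_neq0 notZ2 c1 c2 c3 c4 r.
  have orbit := double_eigenvalue_orbit x0 y0 disc.
  have m_neq0 : (a + d) / 2 != 0 by rewrite mulf_neq0 ?invr_eq0 ?pnatr_eq0.
  have u_neq0 k : c1 + c2 * k%:R != 0.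
    apply: contra_notN notZ2 => /eqP u0; exists k; left.
    by rewrite -u0 /c1 /c2 /=; ring.
  have x0_neq0 : x0 != 0.
    by apply: contraNneq (u_neq0 0%N) => x00; rewrite /c1 x00 !mulr0 addr0.
  rewrite -x0E -y0E in c1 c2 c3 c4 r u_neq0 orbit *.
  apply: (solution_of_linear_orbit Hx Hy
           (u := fun k => c1 + c2 * k%:R) (v := fun k => c3 + c4 * k%:R))
           => // [|k].
    by rewrite /c1 /c3; ring.
  apply: (mulfI m_neq0); rewrite !mulrA.
  by rewrite (orbit k).1 (orbit k).2 mulrC.
- move=> l1 l2 Heig _ disc _ notZ1 l1a l2a C1 C2 C3 C4 r n.
  have [l12 sum12 prod12] := eigenvalues_sum_prod Heig disc.
  have coord := eigen_coordinates x0%:C y0%:C l12 l1a l2a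
                  sum12 prod12.
  have orbit := distinct_eigenvalues_orbit x0%:C y0%:C sum12 prod12.
  have l12_neq0 : l1 - l2 != 0 by rewrite subr_eq0.
  have u_neq0 k : C1 * l1 ^+ k - C2 * l2 ^+ k != 0.
    rewrite (coord k).1 mulf_neq0 ?invr_eq0 //.
    by apply: contra_notN notZ1 => /eqP u0; exists k; left.
  have HxC k : (x k.+1)%:C =
      a%:C * (x k)%:C ^+ 2 * (y k)%:C + b%:C * (x k)%:C * (y k)%:C ^+ 2.
    by rewrite Hx !(rmorphXn, rmorphM, rmorphD).
  have HyC k : (y k.+1)%:C =
      c%:C * (x k)%:C ^+ 2 * (y k)%:C + d%:C * (x k)%:C * (y k)%:C ^+ 2.
    by rewrite Hy !(rmorphXn, rmorphM, rmorphD).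
  have := solution_of_linear_orbit
    (x := fun k => (x k)%:C) (y := fun k => (y k)%:C) HxC HyC
    (u := fun k => C1 * l1 ^+ k - C2 * l2 ^+ k)
    (v := fun k => C3 * l1 ^+ k - C4 * l2 ^+ k) u_neq0.
  rewrite /= x0E y0E; apply.
    rewrite (coord 0%N).1 (coord 0%N).2; ring.
  move=> k; rewrite (coord k).1 (coord k).2 (coord k.+1).1 (coord k.+1).2.
  rewrite (orbit k).1 (orbit k).2; ring.
- move=> _ _ tr0 notZ3 s K L n.
  have dE : d = - a by apply/eqP; rewrite -addr_eq0 addrC tr0.
  have x0_neq0 : x0 != 0.
    by apply: contra_notN notZ3 => /eqP x00; constructor 1; rewrite /= x00 mul0r.
  have u1_neq0 : a * x0 + b * y0 != 0.
    by apply: contra_notN notZ3 => /eqP; constructor 2.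
  pose u k := if odd k then a * x0 + b * y0 else x0.
  pose v k := if odd k then c * x0 + d * y0 else y0.
  have u_neq0 k : u k != 0 by rewrite /u; case: odd.
  have uv k : u k.+1 * (c * u k + d * v k) = v k.+1 * (a * u k + b * v k).
    by rewrite /u /v /=; case: odd; rewrite /= dE; ring.
  have r0 : y 0%N = v 0%N / u 0%N * x 0%N by rewrite x0E y0E divfK.
  have rS := projective_orbit_ratio u_neq0 uv.
  have ratio := ratio_step Hx Hy (r := fun k => v k / u k) r0 rS.
  have even k : odd (2 * k) = false by rewrite oddM.
  have HK k : x (2 * k).+1 = x (2 * k)%N ^+ 3 * K.
    by rewrite (ratio _).2 /u /v even.
  have HL k : x (2 * k).+2 = x (2 * k).+1 ^+ 3 * L.
    by rewrite (ratio _).2 /u /v /= even.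
  have [x_even x_odd] := cubing_recurrence_alt HK HL n.
  rewrite x0E in x_even x_odd.
  split=> //.
    by rewrite (ratio _).1 /u /v even x_even mulrA.
  by rewrite (ratio _).1 /u /v x_odd addn1 /= even !mulrA.
Qed.
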